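(* Let $(x_*, v_*, \lambda_* )$ be an index-1 saddle of $E$. Then there exist $h_0 > 0$ and a constant $C$ (independent of $h$) such that, for all $0 < h \leq h_0$, there exist $x_h, v_h \in X$ and $\lambda_h \in \mathbb{R}$ with $$\tfrac12 \big( \nabla E(x_h + h v_h) + \nabla E(x_h - h v_h)\big) = 0,$$ $$\tfrac1{2h} \big( \nabla E(x_h + h v_h) - \nabla E(x_h - h v_h) \big) = \lambda_h v_h,$$ $$\tfrac12 \| v_h \|^2 = \tfrac12,$$ and moreover $$\| x_h - x_* \| + \| v_h - v_*\| + |\lambda_h - \lambda_*| \leq C h^2.$$
   Context: $X$ is a real Hilbert space with inner product $x\cdot y$ and norm $\|x\|$. $E \in C^4(X)$ is real-valued; $\nabla E(x)\in X$ denotes its gradient (Riesz representative of the derivative) and $\nabla^2 E(x) \in L(X)$ its Hessian, regarded as a bounded linear operator on $X$. A bounded self-adjoint operator $A \in L(X)$ has index-1 saddle structure if it has a unique (up to scaling of the eigenvector) minimal eigenpair $(\lambda, v)$, i.e. $Av=\lambda v$ with $\lambda = \inf\sigma(A)$, and $\lambda<0$, and $A$ is positive definite on $\{v\}^\perp$ (there is $\mu>0$ with $w\cdot(Aw) \geq \mu\|w\|^2$ for all $w\perp v$). A triple $(x_*, v_*, \lambda_* )$ is an index-1 saddle of $E$ if $\nabla E(x_* ) = 0$, $\nabla^2 E(x_* )$ has index-1 saddle structure, and $(\lambda_*, v_* )$ is its minimal eigenpair with $\|v_*\|=1$. *)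

(* Defs.v *)
From HB Require Import structures.
From mathcomp Require Import all_boot all_order all_algebra.
From mathcomp Require Import all_classical all_reals all_analysis.
From mathcomp Require Import sesquilinear.

Set Implicit Arguments.
Unset Strict Implicit.
Unset Printing Implicit Defensive.

Import Order.TTheory GRing.Theory Num.Theory.
Import numFieldNormedType.Exports.

Local Open Scope classical_set_scope.
Local Open Scope ring_scope.

Section BoundedOperators.
Context {R : realType} {V W : normedModType R}.

(* For linear maps between normed spaces, continuous = bounded
   (linear_bounded_continuous). *)
Definition bounded_linear : {pred V -> W} :=
  [pred f : V -> W | `[< linear f /\ continuous f >] ].

Lemma bounded_linearP (f : V -> W) :
  reflect (linear f /\ continuous f) (f \in bounded_linear).
Proof. exact: asboolP. Qed.

Lemma bounded_linear_submod_closed : submod_closed bounded_linear.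
Proof.
split.
  apply/bounded_linearP; split; last by move=> x; exact: cvg_cst.
  by move=> a x y; rewrite [RHS](_ : _ = a *: 0 + 0)// scaler0 addr0.
move=> a f g /bounded_linearP[lf cf] /bounded_linearP[lg cg].
apply/bounded_linearP; split.
  move=> b x y; rewrite [LHS](_ : _ = a *: f (b *: x + y) + g (b *: x + y))//.
  rewrite [RHS](_ : _ = b *: (a *: f x + g x) + (a *: f y + g y))//.
  by rewrite lf lg !scalerDr !scalerA (mulrC b a) addrACA.
by move=> x; apply: cvgD; [apply: cvgZr; exact: cf|exact: cg].
Qed.

HB.instance Definition _ :=
  GRing.isSubmodClosed.Build R (V -> W) bounded_linear
    bounded_linear_submod_closed.

Record bop := Bop {
  bop_fun :> V -> W;
  bop_subproof : bop_fun \in bounded_linear }.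

HB.instance Definition _ := [isSub for bop_fun].
HB.instance Definition _ := [Choice of bop by <:].
HB.instance Definition _ := [SubChoice_isSubLmodule of bop by <:].

Implicit Types A B : bop.

Lemma bop_linear A : linear A.
Proof. by have /bounded_linearP[] := bop_subproof A. Qed.

Lemma bop_continuous A : continuous A.
Proof. by have /bounded_linearP[] := bop_subproof A. Qed.

HB.instance Definition _ A :=
  GRing.isLinear.Build R V W *:%R A (bop_linear A).

Lemma bopP A B : (forall x, A x = B x) -> A = B.
Proof. by move=> AB; apply/val_inj/funext. Qed.

Definition opnorm A : R := sup [set `|A x| | x in [set x | `|x| <= 1]].

Lemma opnorm_has_sup A : has_sup [set `|A x| | x in [set x | `|x| <= 1]].
Proof.
split; first by exists `|A 0|, 0 => //=; rewrite normr0 ler01.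
have /bounded_funP/(_ 1)[M AM] : bounded_near A (nbhs (0 : V)).
  exact/linear_bounded_continuous/bop_continuous.
by exists M => _ [x /= x1 <-]; exact: AM.
Qed.

Lemma opnorm_ge0 A : 0 <= opnorm A.
Proof.
apply: le_trans (normr_ge0 (A 0)) _; apply: sup_upper_bound.
  exact: opnorm_has_sup.
by exists 0 => //=; rewrite normr0 ler01.
Qed.

Lemma le_opnorm A x : `|A x| <= opnorm A * `|x|.
Proof.
have [->|x0] := eqVneq x 0; first by rewrite linear0 !normr0 mulr0.
rewrite -ler_pdivrMr ?normr_gt0//.
have -> : `|A x| / `|x| = `|A (`|x|^-1 *: x)|.
  by rewrite linearZ normrZ ger0_norm ?invr_ge0// mulrC.
apply: sup_upper_bound; first exact: opnorm_has_sup.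
exists (`|x|^-1 *: x) => //=.
by rewrite normrZ ger0_norm ?invr_ge0// mulVf ?normr_eq0.
Qed.

Lemma opnorm_le A (M : R) :
  0 <= M -> (forall x, `|A x| <= M * `|x|) -> opnorm A <= M.
Proof.
move=> M0 AM; apply: ge_sup; first by have [] := opnorm_has_sup A.
move=> _ [x /= x1 <-]; apply: le_trans (AM x) _.
by rewrite -[leRHS]mulr1 ler_wpM2l.
Qed.

Lemma ler_opnormD A B : opnorm (A + B) <= opnorm A + opnorm B.
Proof.
apply: opnorm_le; first by rewrite addr_ge0 ?opnorm_ge0.
move=> x; rewrite mulrDl; apply: le_trans (ler_normD (A x) (B x)) _.
by rewrite lerD ?le_opnorm.
Qed.

Lemma opnormZ (a : R) A : opnorm (a *: A) = `|a| * opnorm A.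
Proof.
have le b B : opnorm (b *: B) <= `|b| * opnorm B.
  apply: opnorm_le; first by rewrite mulr_ge0 ?opnorm_ge0.
  move=> x; rewrite [X in `|X|](_ : _ = b *: B x)// normrZ -mulrA.
  by rewrite ler_wpM2l ?le_opnorm.
apply/eqP; rewrite eq_le le /=.
have [->|a0] := eqVneq a 0; first by rewrite normr0 mul0r opnorm_ge0.
rewrite -ler_pdivlMl ?normr_gt0// -normfV.
by apply: le_trans (le _ _); rewrite scalerA mulVf// scale1r.
Qed.

Lemma opnorm_eq0 A : opnorm A = 0 -> A = 0.
Proof.
move=> A0; apply: bopP => x; apply/eqP; rewrite -normr_le0.
by apply: le_trans (le_opnorm A x) _; rewrite A0 mul0r.
Qed.

HB.instance Definition _ :=
  Lmodule_isNormed.Build R bop ler_opnormD opnormZ opnorm_eq0.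

End BoundedOperators.

Arguments bop {R} V W.

Section FrechetDerivative.
Context {R : realType}.

(* The Frechet derivative as a point of the normed space bop V W;
   it is 0 if 'd f x fails to be continuous. *)
Definition fderiv (V W : normedModType R) (f : V -> W) (x : V) : bop V W :=
  insubd (0 : bop V W) ('d f x : V -> W).

Lemma fderivE (V W : normedModType R) (f : V -> W) (x : V) :
  differentiable f x -> fderiv f x = 'd f x :> (V -> W).
Proof.
move=> dfx; rewrite /fderiv val_insubd ifT//.
apply/bounded_linearP; split; first exact: linearP.
exact: diff_continuous.
Qed.

Fixpoint Ck (k : nat) (V W : normedModType R) (f : V -> W) : Prop :=
  if k is k'.+1 then (forall x, differentiable f x) /\ Ck k' (fderiv f)
  else continuous f.

End FrechetDerivative.

Section Saddle.
Context {R : realType} {X : completeNormedModType R}.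
Variable dot : {dot X for idfun}.

(* The Riesz representative of the derivative of E at x. *)
Definition grad (E : X -> R) (x : X) : X :=
  get [set g : X | forall w, 'd E x w = dot g w].

Definition hess (E : X -> R) (x : X) : bop X X := fderiv (grad E) x.

Definition self_adjoint (A : bop X X) : Prop :=
  forall u w, dot (A u) w = dot u (A w).

(* Real spectrum: A - s I has no bounded two-sided inverse.  A self-adjoint
   operator has no non-real spectrum. *)
Definition spectrum (A : bop X X) : set R :=
  [set s | ~ exists B : bop X X,
     (forall u, B (A u - s *: u) = u) /\ (forall u, A (B u) - s *: B u = u)].

Definition minimal_eigenpair (A : bop X X) (lambda : R) (v : X) : Prop :=
  [/\ v != 0, A v = lambda *: v & lambda = inf (spectrum A)].

Definition index1_saddle_structure (A : bop X X) : Prop :=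
  self_adjoint A /\
  exists lambda v,
    [/\ minimal_eigenpair A lambda v,
        (forall lambda' v', minimal_eigenpair A lambda' v' ->
           lambda' = lambda /\ exists c : R, v' = c *: v),
        lambda < 0 &
        exists mu : R, 0 < mu /\
          forall w, dot w v = 0 -> mu * `|w| ^+ 2 <= dot w (A w)].

Definition index1_saddle (E : X -> R) (x v : X) (lambda : R) : Prop :=
  [/\ grad E x = 0,
      index1_saddle_structure (hess E x),
      minimal_eigenpair (hess E x) lambda v &
      `|v| = 1].

End Saddle.

(* Main.v *)
(* Idea.  Write G for the gradient of E, A = G'(xs) and B = G''(xs).  The two
   central-difference equations and the normalization form a system
   F_h(x, v, l) = 0, whose formal limit at h = 0 is
     (G x, G'(x) v - l v, (|v|^2 - 1) / 2).
   The derivative of this limit at the saddle is block triangular: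
     (y, w, m) |-> (A y, (B y) vs + (A - ls) w - m vs, vs . w).
   On the orthogonal complement of vs both A and A - ls are coercive, so there
   damped Richardson steps with small parameters contract, while the component
   along vs is solved exactly.  This gives an explicit approximate inverse M.
   Rescaling y makes the off-diagonal block B negligible, and then
   z |-> z - M F_h(z) is a contraction near the saddle, uniformly in small h.
   Since |F_h(xs, vs, ls)| = O(h^2) by symmetry of the differences, Banach's
   fixed point theorem applies on a ball of radius O(h^2). *)

Require Import Defs.
From HB Require Import structures.
From mathcomp Require Import all_boot all_order all_algebra.
From mathcomp Require Import all_classical all_reals all_analysis.
From mathcomp Require Import sesquilinear ring lra.

Set Implicit Arguments.
Unset Strict Implicit.
Unset Printing Implicit Defensive.

Import Order.TTheory GRing.Theory Num.Theory.
Import numFieldNormedType.Exports.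

Local Open Scope classical_set_scope.
Local Open Scope ring_scope.

(** * Mean value inequality for curves in a normed space *)

(** Vector values admit no intermediate point, so this is a continuity argument: with the slope
    enlarged to [M + d], the supremum [c] of the points satisfying the bound cannot lie before
    [b]. *)
Lemma mean_value_norm {R : realType} {W : normedModType R} (f f' : R -> W)
    (a b M : R) : a <= b ->
    (forall t, a <= t <= b -> is_derive t 1 f (f' t)) ->
    (forall t, a <= t <= b -> `|f' t| <= M) ->
  `|f b - f a| <= M * (b - a).
Proof.
move=> ab df f'M.
have M0 : 0 <= M by apply: le_trans (f'M a _); rewrite ?lexx.
have cf t : a <= t <= b -> {for t, continuous f}.
  move=> /df dft; apply/differentiable_continuous/derivable1_diffP.
  exact: (@ex_derive _ _ _ _ _ _ _ dft).
apply/ler_addgt0Pr => e e0.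
case: (ltrgtP a b) ab => // [ab _|<- _]; last first.
  by rewrite !subrr normr0 mulr0 add0r ltW.
(* The slack [e] is spread over the interval as extra slope [d]. *)
pose d := e / (b - a).
have d0 : 0 < d by rewrite divr_gt0 ?subr_gt0.
have -> : M * (b - a) + e = (M + d) * (b - a).
  by rewrite mulrDl divfK// subr_eq0 gt_eqF.
pose g t := `|f t - f a| - (M + d) * (t - a).
rewrite -subr_le0 -/(g b) leNgt; apply/negP => gb.
have cg t : a <= t <= b -> {for t, continuous g}.
  move=> tab; apply: cvgB.
    by apply: cvg_norm; apply: cvgB; [exact: cf|exact: cvg_cst].
  apply: cvgM; first exact: cvg_cst.
  by apply: cvgB; [exact: cvg_id|exact: cvg_cst].
pose S := [set t | a <= t <= b /\ g t <= 0].
have Sa : S a.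
  by split; [rewrite lexx ltW|rewrite /g !subrr normr0 mulr0 subr0 lexx].
have ubS : ubound S b by move=> t [/andP[]].
have supS : has_sup S by split; [exists a|exists b].
pose c := sup S.
have ac : a <= c by exact: sup_upper_bound.
have cb : c <= b by apply: ge_sup => //; exists a.
have gc : g c <= 0.
  rewrite leNgt; apply/negP => gc.
  have : \forall t \near c, 0 < g t.
    have := cg c; rewrite ac cb => /(_ isT) /cvgrPdist_lt /(_ _ gc).
    by apply: filterS => t; rewrite ltr_distlC => /andP[+ _]; rewrite subrr.
  move=> /nbhs_ballP[r /= r0 br].
  have [t [tab gt] ct] := sup_adherent r0 supS.
  have tc : t <= c by exact: sup_upper_bound.
  suff : 0 < g t by rewrite ltNge gt.
  by apply: br; rewrite -ball_normE /= ger0_norm ?subr_ge0// ltrBlDl -ltrBlDr.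
(* The bound holds at c but at no later point, which contradicts the size of
   the derivative at c. *)
have cltb : c < b.
  by rewrite lt_neqAle cb andbT; apply: contraTneq gb => <-; rewrite -leNgt.
have [dc dcE] := df c (introT andP (conj ac cb)).
have : h^-1 *: (f (h *: 1 + c) - f c) @[h --> 0^'] --> f' c.
  by rewrite -dcE.
move=> /cvgrPdist_lt /(_ _ d0) /nbhs_ballP[r /= r0 br].
pose h := Num.min (r / 2) (b - c).
have h0 : 0 < h by rewrite lt_min divr_gt0//= subr_gt0.
have hr : h < r by rewrite gt_min ltr_pdivrMr// ltr_pMr// ltr1n.
have hb : h <= b - c by rewrite ge_min lexx orbT.
have /br : ball (0 : R) r h by rewrite -ball_normE /= sub0r normrN gtr0_norm.
move=> /(_ (lt0r_neq0 h0)) /=; rewrite [h *: 1]mulr1 => fh.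
have fhc : `|f (h + c) - f c| <= (M + d) * h.
  rewrite -ler_pdivrMr// mulrC -[X in X * _](gtr0_norm (x := h^-1)) ?invr_gt0//.
  rewrite -normrZ -[X in `|X|](subrK (f' c)) addrC.
  apply: le_trans (ler_normD _ _) _; apply: lerD; first by rewrite f'M ?ac.
  by rewrite distrC ltW.
have hcb : h + c <= b by rewrite -lerBrDr.
have ghc : 0 < g (h + c).
  rewrite ltNge; apply/negP => ghc.
  have : h + c <= c.
    apply: sup_upper_bound => //; split=> //.
    by rewrite hcb andbT (le_trans ac)// lerDr ltW.
  by rewrite gerDr leNgt h0.
move: ghc; rewrite ltNge => /negP; apply.
rewrite /g subr_le0.
have -> : f (h + c) - f a = (f (h + c) - f c) + (f c - f a) by rewrite subrKA.
apply: le_trans (ler_normD _ _) _; rewrite -addrA mulrDr lerD//.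
by rewrite -subr_le0.
Qed.

(** * Smooth maps and operator-valued derivatives *)

Section Smoothness.
Context {R : realType}.
Implicit Types U V W : normedModType R.

Lemma bounded_linearI V W (f : V -> W) (M : R) :
  linear f -> (forall x, `|f x| <= M * `|x|) -> f \in bounded_linear.
Proof.
move=> lf fM; apply/bounded_linearP; split=> //.
pose fl : {linear V -> W} := HB.pack f (GRing.isLinear.Build _ _ _ _ _ lf).
apply: (@bounded_linear_continuous _ _ _ fl); apply/linear_boundedP.
exists M; split; first exact: num_real.
by move=> r /ltW Mr x; rewrite (le_trans (fM x))// ler_wpM2r.
Qed.

Lemma is_derive_line V W (f : V -> W) (x v : V) (t : R) :
  differentiable f (x + t *: v) ->
  is_derive t 1 (fun s : R => f (x + s *: v)) (fderiv f (x + t *: v) v).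
Proof.
move=> df; rewrite fderivE// -deriveE//.
have E : (fun h : R => h^-1 *: (f (x + (h *: 1 + t) *: v) - f (x + t *: v)))
    = (fun h : R => h^-1 *: (f (h *: v + (x + t *: v)) - f (x + t *: v))).
  by apply: funext => h; rewrite [h *: 1]mulr1 scalerDl addrCA.
split; last by rewrite /derive /= E.
by move: (diff_derivable (v := v) df); rewrite /derivable /= E.
Qed.

Lemma is_derive_scalel W (c : W) (t : R) :
  is_derive t (1 : R) (fun s : R => s *: c) c.
Proof.
apply: DeriveDef; first exact/diff_derivable.
by rewrite deriveE// diff_val scale1r.
Qed.

Lemma ler_norm_bop V W (A : bop V W) (x : V) : `|A x| <= `|A| * `|x|.
Proof. exact: le_opnorm. Qed.

(** Subtracting the linear curve [s *: c] before applying the mean value inequality compares the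
    increment of [f] with any prescribed vector [c]. *)
Lemma mean_value_line V W (f : V -> W) (x y : V) (c : W) (M : R) :
    (forall z, differentiable f z) ->
    (forall t, 0 <= t <= 1 ->
      `|fderiv f (x + t *: (y - x)) (y - x) - c| <= M) ->
  `|f y - f x - c| <= M.
Proof.
move=> df fM.
have dg (t : R) : is_derive t 1 (fun s : R => f (x + s *: (y - x)) - s *: c)
    (fderiv f (x + t *: (y - x)) (y - x) - c).
  apply: is_deriveB; first exact: is_derive_line.
  exact: is_derive_scalel.
have := mean_value_norm ler01 (fun t _ => dg t) fM.
rewrite scale1r subrKC scale1r scale0r addr0 scale0r !subr0 mulr1.
by rewrite addrAC.
Qed.

Lemma CkS (k : nat) V W (f : V -> W) : Ck k.+1 f -> Ck k f.
Proof.
elim: k W f => [|k IH] W f [df Cf']; last by split=> //; exact: IH.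
by move=> x; exact/differentiable_continuous.
Qed.

(** Strict differentiability: both endpoints vary, as a Lipschitz estimate requires. A ball is
    convex, so the segment from [b] to [a] stays where [fderiv f] is close to its value at [x]. *)
Lemma Ck1_strict V W (f : V -> W) (x : V) : Ck 1 f ->
  forall e, 0 < e -> exists2 d, 0 < d &
    forall a b, `|a - x| <= d -> `|b - x| <= d ->
      `|f a - f b - fderiv f x (a - b)| <= e * `|a - b|.
Proof.
move=> [df cf] e e0.
have /cvgrPdist_le /(_ _ e0) /nbhs_ballP[d /= d0 fd] := cf x.
exists (d / 2) => [|a b ad bd]; first by rewrite divr_gt0.
apply: mean_value_line => // t /andP[t0 t1].
apply: le_trans (ler_norm_bop (fderiv f (b + t *: (a - b)) - fderiv f x) _) _.
rewrite ler_wpM2r// distrC; apply: fd.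
rewrite -ball_normE /= distrC.
have -> : b + t *: (a - b) - x = t *: (a - x) + (1 - t) *: (b - x).
  have -> : a - b = (a - x) - (b - x) by rewrite opprB addrA subrK.
  by rewrite addrAC scalerBr scalerBl scale1r addrCA.
apply: le_lt_trans (ler_normD _ _) _; rewrite !normrZ.
rewrite !ger0_norm ?subr_ge0//.
apply: le_lt_trans (_ : d / 2 < d); last first.
  by rewrite ltr_pdivrMr// ltr_pMr// ltr1n.
have -> : d / 2 = t * (d / 2) + (1 - t) * (d / 2).
  by rewrite -mulrDl addrC subrK mul1r.
by rewrite lerD// ler_wpM2l// subr_ge0.
Qed.

Lemma Ck1_locally_lipschitz V W (f : V -> W) (x : V) : Ck 1 f ->
  exists K d, [/\ 0 <= K, 0 < d &
    forall a b, `|a - x| <= d -> `|b - x| <= d -> `|f a - f b| <= K * `|a - b|].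
Proof.
move=> /(Ck1_strict x) /(_ _ ltr01) [d d0 fd].
exists (1 + `|fderiv f x|), d; split=> // a b ad bd.
rewrite -(subrK (fderiv f x (a - b)) (f a - f b)) mulrDl.
by apply: le_trans (ler_normD _ _) _; rewrite lerD ?fd ?ler_norm_bop.
Qed.

(** The first-order terms cancel: along the segment the derivative is a difference of [fderiv f] at
    points symmetric about [x], applied to [h *: v]. The Lipschitz bound gives one factor [h] and
    the argument gives the other. *)
Lemma Ck2_symmetric_sum V W (f : V -> W) (x v : V) : Ck 2 f ->
  exists C r, [/\ 0 <= C, 0 < r & forall h : R, `|h| <= r ->
    `|f (x + h *: v) + f (x - h *: v) - 2 *: f x| <= C * h ^+ 2].
Proof.
move=> [df /(Ck1_locally_lipschitz x) [K [d [K0 d0 fK]]]].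
have N0 : 0 < `|v| + 1 by rewrite ltr_wpDl.
(* The summand 1 keeps the radius meaningful when [v] is 0. *)
exists (2 * K * `|v| ^+ 2), (d / (`|v| + 1)); split.
- by rewrite mulr_ge0 ?mulr_ge0 ?exprn_ge0.
- by rewrite divr_gt0.
move=> h; rewrite ler_pdivlMr// => hd.
have hvd t : 0 <= t <= 1 -> `|t *: (h *: v)| <= d.
  move=> /andP[t0 t1]; rewrite normrZ ger0_norm// normrZ.
  apply: le_trans (_ : 1 * (`|h| * (`|v| + 1)) <= d); last by rewrite mul1r.
  by rewrite ler_pM ?mulr_ge0// ler_wpM2l// lerDl.
have dg (t : R) : is_derive t 1
    (fun s : R => f (x + s *: (h *: v)) + f (x + s *: (- (h *: v))))
    (fderiv f (x + t *: (h *: v)) (h *: v) +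
     fderiv f (x + t *: (- (h *: v))) (- (h *: v))).
  by apply: is_deriveD; exact: is_derive_line.
have /(_ (2 * K * `|v| ^+ 2 * h ^+ 2)) :=
  mean_value_norm ler01 (fun t _ => dg t).
rewrite !scale1r !scale0r !addr0 subr0 mulr1 scaler_nat mulr2n.
apply=> t t01; rewrite linearN scalerN.
rewrite -[X in `|X|]/((fderiv f (x + t *: (h *: v)) -
   fderiv f (x - t *: (h *: v))) (h *: v)).
apply: le_trans (ler_norm_bop _ _) _.
have := fK (x + t *: (h *: v)) (x - t *: (h *: v)).
rewrite [x + _]addrC addrK [x - _]addrC addrK normrN hvd// => /(_ isT isT) fKt.
apply: le_trans (ler_wpM2r (normr_ge0 _) fKt) _.
rewrite opprD opprK addrACA subrr addr0.
have -> : 2 * K * `|v| ^+ 2 * h ^+ 2 = K * (`|h *: v| + `|h *: v|) * `|h *: v|.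
  by rewrite normrZ -(real_normK (num_real h)); ring.
rewrite ler_wpM2r// ler_wpM2l//; apply: le_trans (ler_normD _ _) _.
by move: t01 => /andP[t0 t1]; rewrite lerD// normrZ ger0_norm// ler_piMl.
Qed.

End Smoothness.

(** * Composition with bounded operators *)

Section Composition.
Context {R : realType}.

Lemma bop_comp_subproof (U V W : normedModType R) (L : bop V W) (A : bop U V) :
  (fun x => L (A x)) \in bounded_linear.
Proof.
apply: (@bounded_linearI _ _ _ _ (`|L| * `|A|)) => [a x y|x].
  by rewrite !linearP.
apply: le_trans (ler_norm_bop L _) _.
by rewrite -mulrA ler_wpM2l// ler_norm_bop.
Qed.

Definition bop_comp (U V W : normedModType R) (L : bop V W) (A : bop U V) :
  bop U W := Bop (bop_comp_subproof L A).

Lemma bop_postcomp_subproof (U V W : normedModType R) (L : bop V W) :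
  (bop_comp L : bop U V -> bop U W) \in bounded_linear.
Proof.
apply: (@bounded_linearI _ _ _ _ `|L|) => [a A B|A].
  by apply: bopP => x; exact: linearP.
apply: opnorm_le => [|x]; first exact: mulr_ge0.
apply: le_trans (ler_norm_bop L _) _.
by rewrite -mulrA ler_wpM2l// ler_norm_bop.
Qed.

Definition bop_postcomp (U V W : normedModType R) (L : bop V W) :
  bop (bop U V) (bop U W) := Bop (bop_postcomp_subproof U L).

Lemma bop_differentiable (V W : normedModType R) (L : bop V W) (x : V) :
  differentiable L x.
Proof. by apply: linear_differentiable => y; exact: bop_continuous. Qed.

Lemma fderiv_bop_comp (U V W : normedModType R) (L : bop V W) (f : U -> V)
  (x : U) : differentiable f x -> fderiv (L \o f) x = bop_comp L (fderiv f x).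
Proof.
move=> df; have dL := bop_differentiable L (f x).
apply: bopP => u; rewrite fderivE; last exact: differentiable_comp.
rewrite diff_comp//= fderivE// diff_lin//.
by move=> y; exact: bop_continuous.
Qed.

(** Differentiating [L \o f] gives postcomposition with [L], again a bounded operator, after
    [fderiv f]; hence the induction generalizes over the spaces and [L]. *)
Lemma Ck_bop_comp (k : nat) (U V W : normedModType R) (L : bop V W)
  (f : U -> V) : Ck k f -> Ck k (L \o f).
Proof.
elim: k V W L f => [|k IH] V W L f /=.
  by move=> cf x; apply: continuous_comp; [exact: cf|exact: bop_continuous].
move=> [df cf]; split.
  by move=> x; apply: differentiable_comp => //; exact: bop_differentiable.
rewrite (_ : fderiv (L \o f) = bop_postcomp U L \o fderiv f); first exact: IH.
by apply: funext => x; rewrite fderiv_bop_comp.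
Qed.

End Composition.

(** * Inner product, Riesz representation and smoothness of the gradient *)

Section Hilbert.
Context {R : realType} {X : completeNormedModType R}.
Variable dot : {dot X for idfun}.
Hypothesis dot_norm : forall x : X, `|x| ^+ 2 = dot x x.

Lemma dotC u v : dot u v = dot v u.
Proof. by rewrite (hermC dot) expr0 mul1r. Qed.

Lemma dotDl u v w : dot (u + v) w = dot u w + dot v w.
Proof. exact: linearDl. Qed.

Lemma dotDr u v w : dot u (v + w) = dot u v + dot u w.
Proof. exact: linearDr. Qed.

Lemma dotNl u v : dot (- u) v = - dot u v.
Proof. exact: linearNl. Qed.

Lemma dotBl u v w : dot (u - v) w = dot u w - dot v w.
Proof. exact: linearBl. Qed.

Lemma dotBr u v w : dot u (v - w) = dot u v - dot u w.
Proof. exact: linearBr. Qed.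

Lemma dotZl a u v : dot (a *: u) v = a * dot u v.
Proof. exact: linearZl_LR. Qed.

Lemma dotZr a u v : dot u (a *: v) = a * dot u v.
Proof. exact: linearZr_LR. Qed.

Lemma normB_sqr u v : `|u - v| ^+ 2 = `|u| ^+ 2 - 2 * dot u v + `|v| ^+ 2.
Proof.
rewrite !dot_norm linearBl !linearBr/= (dotC v u); ring.
Qed.

Lemma normD_sqr u v : `|u + v| ^+ 2 = `|u| ^+ 2 + 2 * dot u v + `|v| ^+ 2.
Proof.
rewrite !dot_norm linearDl !linearDr/= (dotC v u); ring.
Qed.

(** Cauchy-Schwarz, by expanding the squared norm of [|v|^2 u - (u.v) v]. *)
Lemma dot_le_norm u v : `|dot u v| <= `|u| * `|v|.
Proof.
have [->|v0] := eqVneq v 0; first by rewrite linear0r !normr0 mulr0.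
rewrite -ler_sqr ?nnegrE ?mulr_ge0// real_normK ?num_real// exprMn.
have v2 : 0 < `|v| ^+ 2 by rewrite exprn_gt0// normr_gt0.
have := sqr_ge0 `|(`|v| ^+ 2) *: u - dot u v *: v|.
rewrite normB_sqr !normrZ !exprMn dotZl dotZr.
rewrite !normr_id (real_normK (num_real (dot u v))).
have -> : (`|v| ^+ 2) ^+ 2 * `|u| ^+ 2 - 2 * (`|v| ^+ 2 * (dot u v * dot u v))
    + dot u v ^+ 2 * `|v| ^+ 2
    = `|v| ^+ 2 * (`|u| ^+ 2 * `|v| ^+ 2 - dot u v ^+ 2).
  by ring.
by rewrite pmulr_rge0// subr_ge0.
Qed.

(* The representative is the minimizer of J x = |x|^2 - 2 phi x: by the
   parallelogram identity the sublevel sets of J near its infimum shrink. *)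
Lemma riesz_representation (phi : bop X R) :
  exists g, forall w, phi w = dot g w.
Proof.
have phiD x y : phi (x + y) = phi x + phi y by exact: linearD.
have phiZ a x : phi (a *: x) = a * phi x by exact: linearZ.
pose J x := `|x| ^+ 2 - 2 * phi x.
have J_lb x : - `|phi| ^+ 2 <= J x.
  have := ler_norm_bop phi x; move: (ler_norm (phi x)); rewrite /J => h1 h2.
  have := sqr_ge0 (`|x| - `|phi|); nra.
have infJ : has_inf (range J).
  by split; [exists (J 0), 0|exists (- `|phi| ^+ 2) => _ [x _ <-]].
pose j := inf (range J).
have j_le x : j <= J x by apply: ge_inf; [exact: infJ.2|exists x].
pose B e := [set x | J x < j + e].
pose F := filter_from [set e : R | 0 < e] B.
have FF : ProperFilter F.
  apply: filter_from_proper => [|e /= e0].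
    apply: filter_from_filter; first by exists 1 => /=.
    move=> a b /= a0 b0; exists (Num.min a b) => /=; first by rewrite lt_min a0.
    by move=> x; rewrite /B /= -ltrBlDl lt_min => /andP[]; rewrite !ltrBlDl.
  by have [_ [x _ <-] Jx] := inf_adherent e0 infJ; exists x.
(* The parallelogram identity reads [|x - y|^2 = 2 J x + 2 J y - 4 J m] with [m] the midpoint, and
   [J m] is at least [j]. *)
have B_dist e x y : B e x -> B e y -> `|x - y| ^+ 2 <= 4 * e.
  rewrite /B /= => Bx By; have := j_le (2^-1 *: (x + y)).
  rewrite /J phiZ phiD normrZ exprMn ger0_norm ?invr_ge0//.
  move: Bx By; rewrite /J !normB_sqr !normD_sqr; nra.
have /cauchy_cvg/cvg_ex[g Fg] : cauchy F.
  (* This [d] makes [4 * d] the square of [e / 2]; halving [e] yields the strict inequality of an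
     open ball. *)
  apply: cauchy_exP => e e0; pose d := (e / 2) ^+ 2 / 4.
  have d0 : 0 < d by rewrite !divr_gt0 ?exprn_gt0 ?divr_gt0.
  have [_ [x _ <-] Jx] := inf_adherent d0 infJ; exists x; exists d => // y By.
  have e2 : e / 2 < e by rewrite ltr_pdivrMr// ltr_pMr// ltr1n.
  rewrite -ball_normE /=; apply: le_lt_trans _ e2.
  rewrite -ler_sqr ?nnegrE ?divr_ge0 1?(ltW e0)//.
  by apply: le_trans (B_dist d x y Jx By) _; rewrite mulrC divfK.
have Jg : J g <= j.
  apply/ler_addgt0Pr => e e0.
  have JF : J x @[x --> F] --> J g.
    apply: cvgB; first by apply: cvgM; apply: cvg_norm.
    apply: cvgM; first exact: cvg_cst.
    exact: cvg_trans (cvg_app _ Fg) (@bop_continuous _ _ _ phi g).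
  by apply: cvgr_to_le JF _; exists e => // x; rewrite /B /= => /ltW.
exists g => w; apply/eqP; rewrite -subr_eq0.
(* Minimality is tested at [g + u w] with [u = d / N]: there [J] equals [J g - u^2 (N + 1)], which
   forces [u = 0]. The 1 in [N] covers [w = 0]. *)
set d := phi w - dot g w; pose N := `|w| ^+ 2 + 1.
have N0 : 0 < N by rewrite ltr_wpDl// exprn_ge0.
have := le_trans Jg (j_le (g + (d / N) *: w)).
rewrite /J normD_sqr dotZr phiD phiZ normrZ exprMn.
rewrite (real_normK (num_real _)).
have -> : `|w| ^+ 2 = N - 1 by rewrite addrK.
have -> : phi w = d / N * N + dot g w by rewrite divfK ?gt_eqF// subrK.
set u := d / N => Ju.
have : u ^+ 2 * (N + 1) <= 0 by nra.
rewrite pmulr_lle0; last exact: addr_gt0.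
move=> u2.
have : u ^+ 2 == 0 by rewrite eq_le u2 sqr_ge0.
by rewrite sqrf_eq0 mulf_eq0 invr_eq0 (gt_eqF N0) orbF.
Qed.

(** The same choice as in [grad], so that [grad] becomes [riesz] after [fderiv] wherever [E] is
    differentiable. *)
Definition riesz (phi : bop X R) : X :=
  get [set g : X | forall w, phi w = dot g w].

Lemma rieszE (phi : bop X R) w : phi w = dot (riesz phi) w.
Proof.
exact: (getPex (P := [set g | forall w, phi w = dot g w])
  (riesz_representation phi)).
Qed.

Lemma dot_inj u v : (forall w, dot u w = dot v w) -> u = v.
Proof.
move=> uv; apply/eqP; rewrite -subr_eq0 -normr_eq0 -sqrf_eq0 dot_norm.
by rewrite dotBl uv subrr.
Qed.

(** Linearity follows from uniqueness of the representative [r]; the bound 1 comes from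
    [|r|^2 = phi r <= |phi| |r|]. *)
Lemma riesz_subproof : riesz \in bounded_linear.
Proof.
apply: (@bounded_linearI _ _ _ _ 1) => [a phi psi|phi].
  by apply: dot_inj => w; rewrite dotDl dotZl -!rieszE.
rewrite mul1r; have [->|r0] := eqVneq (riesz phi) 0; first by rewrite normr0.
rewrite -(ler_pM2r (x := `|riesz phi|)) ?normr_gt0// -expr2 dot_norm -rieszE.
by apply: le_trans (ler_norm _) _; exact: ler_norm_bop.
Qed.

Lemma gradE (E : X -> R) (x : X) :
  differentiable E x -> grad dot E x = riesz (fderiv E x).
Proof. by move=> dE; rewrite /riesz fderivE. Qed.

Lemma Ck_grad (k : nat) (E : X -> R) : Ck k.+1 E -> Ck k (grad dot E).
Proof.
move=> [dE CE].
rewrite (_ : grad dot E = Bop riesz_subproof \o fderiv E).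
  exact: Ck_bop_comp.
by apply: funext => x; rewrite gradE.
Qed.

End Hilbert.

(** * Central differences *)

Section CentralDifferences.
Context {R : realType}.
Implicit Types V W : normedModType R.

Definition central_average V W (f : V -> W) (h : R) (x v : V) : W :=
  2^-1 *: (f (x + h *: v) + f (x - h *: v)).

Definition central_difference V W (f : V -> W) (h : R) (x v : V) : W :=
  (2 * h)^-1 *: (f (x + h *: v) - f (x - h *: v)).

(** The quotient behaves as an average of [f'] over the symmetric interval, so the bound does not
    deteriorate as [h] tends to 0. *)
Lemma central_mean_value W (f f' : R -> W) (h : R) (c : W) (M : R) : 0 < h ->
    (forall t, - h <= t <= h -> is_derive t 1 f (f' t)) ->
    (forall t, - h <= t <= h -> `|f' t - c| <= M) ->
  `|(2 * h)^-1 *: (f h - f (- h)) - c| <= M.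
Proof.
move=> h0 df f'M; have hh : - h <= h by rewrite ge0_cp// ltW.
have dg t : - h <= t <= h -> is_derive t 1 (fun s => f s - s *: c) (f' t - c).
  by move=> th; apply: is_deriveB; [exact: df|exact: is_derive_scalel].
have h2 : 0 < 2 * h by rewrite mulr_gt0.
have := mean_value_norm hh dg f'M.
rewrite opprK -mulr2n -[h *+ 2]mulr_natl -ler_pdivrMr//; apply: le_trans.
rewrite [leRHS]mulrC -[X in _ <= X * _](gtr0_norm (x := (2 * h)^-1)).
  rewrite -normrZ scaleNr opprK.
  rewrite [X in _ <= `|_ *: X|](_ : _ = f h - f (- h) - (2 * h) *: c).
    by rewrite [in leRHS]scalerBr scalerA mulVf ?gt_eqF// scale1r.
  by rewrite opprD addrACA -opprD -mulr2n -scaler_nat scalerA.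
by rewrite invr_gt0.
Qed.

Lemma near_line V (x v : V) (d : R) : 0 < d ->
  exists r, [/\ 0 < r, r <= 1 & forall (y w : V) (t : R), `|y - x| <= r ->
    `|w - v| <= r -> `|t| <= r -> `|y + t *: w - x| <= d].
Proof.
move=> d0; have N0 : 0 < `|v| + 2 by rewrite ltr_wpDl.
(* The displacement of [y] costs at most [r], and [t *: w] at most [r * (|v| + 1)] because
   [r <= 1]. *)
exists (Num.min 1 (d / (`|v| + 2))); set r := Num.min _ _.
have r1 : r <= 1 by rewrite ge_min lexx.
split=> // [|y w t yr wr tr]; first by rewrite lt_min ltr01 divr_gt0.
have rd : r * (`|v| + 2) <= d by rewrite -ler_pdivlMr// ge_min lexx orbT.
have wv : `|w| <= `|v| + 1.
  rewrite -[w](subrK v) addrC (le_trans (ler_normD _ _))// lerD2l.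
  exact: le_trans wr r1.
rewrite addrAC (le_trans (ler_normD _ _))// normrZ.
apply: le_trans rd; rewrite (_ : `|v| + 2 = 1 + (`|v| + 1)); last by ring.
by rewrite mulrDr mulr1 lerD// ler_pM.
Qed.

(** The error is the mean of the linearization defects at the shifts [h] and [- h]; the
    contributions of [v1 - v2] to the linear part are opposite and cancel. *)
Lemma central_average_strict V W (f : V -> W) (x v : V) (e : R) : Ck 1 f ->
  0 < e -> exists2 r, 0 < r & forall h x1 x2 v1 v2, 0 < h -> h <= r ->
    `|x1 - x| <= r -> `|x2 - x| <= r -> `|v1 - v| <= r -> `|v2 - v| <= r ->
    `|central_average f h x1 v1 - central_average f h x2 v2
      - fderiv f x (x1 - x2)| <= e * (`|x1 - x2| + `|v1 - v2|).
Proof.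
move=> C1f e0; have [d d0 fd] := Ck1_strict x C1f e0.
have [r [r0 r1 rd]] := near_line x v d0.
exists r => // h x1 x2 v1 v2 h0 hr x1r x2r v1r v2r.
pose D s := f (x1 + s *: v1) - f (x2 + s *: v2)
  - fderiv f x (x1 - x2 + s *: (v1 - v2)).
have Ds s : `|s| <= h -> `|D s| <= e * (`|x1 - x2| + `|v1 - v2|).
  move=> sh; have sr := le_trans sh hr.
  have E : x1 - x2 + s *: (v1 - v2) = (x1 + s *: v1) - (x2 + s *: v2).
    by rewrite scalerBr opprD addrACA.
  rewrite /D E; apply: le_trans (fd _ _ _ _) _; [exact: rd|exact: rd|].
  rewrite -E ler_wpM2l ?(ltW e0)// (le_trans (ler_normD _ _))// lerD2l normrZ.
  by rewrite ler_piMl// (le_trans sr).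
have -> : central_average f h x1 v1 - central_average f h x2 v2
      - fderiv f x (x1 - x2) = 2^-1 *: (D h + D (- h)).
  have DE s : D s = f (x1 + s *: v1) - f (x2 + s *: v2)
      - (fderiv f x (x1 - x2) + s *: fderiv f x (v1 - v2)).
    by rewrite /D linearD linearZ.
  rewrite !DE /central_average -scalerBr !scaleNr; set l := fderiv f x _.
  set m := h *: fderiv f x _.
  have half2 : 2^-1 + 2^-1 = 1 :> R by field.
  rewrite [X in _ - X = _](_ : l = 2^-1 *: (l + l)); last first.
    by rewrite scalerDr -scalerDl half2 scale1r.
  rewrite -scalerBr; congr (_ *: _).
  rewrite addrACA -[in RHS]opprD [l + m + _]addrACA subrr addr0.
  by rewrite opprD addrACA.
rewrite normrZ ger0_norm ?invr_ge0// mulrC ler_pdivrMr//.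
apply: le_trans (ler_normD _ _) _; rewrite mulr2n mulrDr mulr1.
by rewrite lerD// Ds// ?normrN ger0_norm ?(ltW h0).
Qed.

(** Dividing by [2 * h] is harmless: by [central_mean_value] it is enough to estimate the derivative
    in [t] of [f (x1 + t *: v1) - f (x2 + t *: v2)], uniformly for [t] between [- h] and [h]. *)
Lemma central_difference_strict V W (f : V -> W) (x v : V) (e : R) : Ck 2 f ->
  0 < e -> exists2 r, 0 < r & forall h x1 x2 v1 v2, 0 < h -> h <= r ->
    `|x1 - x| <= r -> `|x2 - x| <= r -> `|v1 - v| <= r -> `|v2 - v| <= r ->
    `|central_difference f h x1 v1 - central_difference f h x2 v2
      - (fderiv (fderiv f) x (x1 - x2) v + fderiv f x (v1 - v2))|
    <= e * (`|x1 - x2| + `|v1 - v2|).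
Proof.
move=> [df C1f'] e0; pose f' := fderiv f; pose B := fderiv f' x.
pose N := `|v| + 1; have N1 : 1 <= N by rewrite lerDr.
have N0 : 0 < N by rewrite (lt_le_trans ltr01).
(* [N] bounds the directions [v1] and [v2]. Terms with [e1] cost at most [e / 4] each, and [r] below
   makes those with [r * b] cost at most [e / 2]. *)
pose e1 := e / (4 * N); have e10 : 0 < e1 by rewrite divr_gt0 ?mulr_gt0.
have [d1 d10 fd1] := Ck1_strict x C1f' e10.
have [d2 d20 fd2] : exists2 d2, 0 < d2 &
    forall y, `|y - x| <= d2 -> `|f' y - f' x| <= e1.
  have [K [d [K0 d0 fK]]] := Ck1_locally_lipschitz x C1f'.
  exists (Num.min d (e1 / (K + 1))).
    by rewrite lt_min d0 divr_gt0// ltr_wpDl.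
  move=> y; rewrite le_min => /andP[yd].
  rewrite ler_pdivlMr ?ltr_wpDl// => ye.
  apply: le_trans (fK y x yd _) _; first by rewrite subrr normr0 ltW.
  by apply: le_trans ye; rewrite mulrC ler_wpM2l// lerDl.
have d0 : 0 < Num.min d1 d2 by rewrite lt_min d10.
have [r' [r'0 r'1 r'd]] := near_line x v d0.
pose b := `|B| + 1; have b0 : 0 < b by rewrite ltr_wpDl.
pose r := Num.min r' (e / (2 * b * N)).
have r0 : 0 < r by rewrite lt_min r'0 divr_gt0// mulr_gt0// mulr_gt0.
have rr' : r <= r' by rewrite ge_min lexx.
have re : r * (2 * b * N) <= e.
  by rewrite -ler_pdivlMr ?mulr_gt0// ge_min lexx orbT.
exists r => // h x1 x2 v1 v2 h0 hr x1r x2r v1r v2r.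
pose g (t : R) := f (x1 + t *: v1) - f (x2 + t *: v2).
pose g' (t : R) := f' (x1 + t *: v1) v1 - f' (x2 + t *: v2) v2.
have -> : central_difference f h x1 v1 - central_difference f h x2 v2
    = (2 * h)^-1 *: (g h - g (- h)).
  rewrite /central_difference -scalerBr /g !scaleNr.
  by rewrite opprD addrACA -opprD.
apply: (central_mean_value (f' := g')) => // [t _|t /andP[ht th]].
  by apply: is_deriveB; exact: is_derive_line.
have tr : `|t| <= r by rewrite ler_norml (le_trans _ ht) ?lerN2// (le_trans th).
have tr' := le_trans tr rr'.
have near_d y w : `|y - x| <= r -> `|w - v| <= r ->
    `|y + t *: w - x| <= d1 /\ `|y + t *: w - x| <= d2.
  move=> yr wr; have := r'd y w t (le_trans yr rr') (le_trans wr rr') tr'.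
  by rewrite le_min => /andP.
set p1 := x1 + t *: v1; set p2 := x2 + t *: v2.
have [p1d1 p1d2] := near_d _ _ x1r v1r; have [p2d1 p2d2] := near_d _ _ x2r v2r.
have pE : p1 - p2 = (x1 - x2) + t *: (v1 - v2).
  by rewrite scalerBr opprD addrACA.
(* Four errors: the strict-differentiability defect of [f'], the replacement of [v] by [v1], the
   shift by [t], and the variation of [f'] between [x] and [p2]. *)
have -> : g' t - (B (x1 - x2) v + f' x (v1 - v2)) =
    (f' p1 - f' p2 - B (p1 - p2)) v1 + B (x1 - x2) (v1 - v)
    + t *: B (v1 - v2) v1 + (f' p2 - f' x) (v1 - v2).
  have Bp : B (p1 - p2) v1 = B (x1 - x2) v1 + t *: B (v1 - v2) v1.
    have -> : B (p1 - p2) = B (x1 - x2) + t *: B (v1 - v2).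
      by rewrite pE linearD linearZ.
    by [].
  have -> : (f' p1 - f' p2 - B (p1 - p2)) v1
      = f' p1 v1 - f' p2 v1 - B (p1 - p2) v1 by [].
  have -> : (f' p2 - f' x) (v1 - v2) = f' p2 v1 - f' p2 v2 - f' x (v1 - v2).
    by rewrite -[LHS]/(f' p2 (v1 - v2) - f' x (v1 - v2)) linearB.
  have -> : B (x1 - x2) (v1 - v) = B (x1 - x2) v1 - B (x1 - x2) v.
    by rewrite linearB.
  rewrite Bp /g' -/p1 -/p2.
  move: (B (x1 - x2) v1) (t *: _) (B (x1 - x2) v) => b1 b2 b3.
  move: (f' p1 v1) (f' p2 v1) (f' p2 v2) (f' x (v1 - v2)) => a1 a2 a3 a4.
  rewrite (addrAC _ (b1 - b3) b2) (opprD b1 b2) (addrA (a1 - a2)) subrK subrKA.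
  rewrite (addrAC (a1 - a2)) -(addrA a2) subrKA opprD !addrA.
  by rewrite (addrAC _ (- b3)).
have N4 : 4 * N != 0 by rewrite mulf_neq0// gt_eqF.
set dx := `|x1 - x2|; set dv := `|v1 - v2|.
have dp : `|p1 - p2| <= dx + dv.
  rewrite pE (le_trans (ler_normD _ _))// lerD2l normrZ ler_piMl//.
  exact: le_trans tr' r'1.
have wv w : `|w - v| <= r -> `|w| <= N.
  move=> wr; rewrite -[w](subrK v) addrC (le_trans (ler_normD _ _))// lerD2l.
  exact: le_trans wr (le_trans rr' r'1).
have T1 : `|(f' p1 - f' p2 - B (p1 - p2)) v1| <= e1 * (dx + dv) * N.
  apply: le_trans (ler_norm_bop _ _) _; rewrite ler_pM ?wv//.
  by apply: le_trans (fd1 _ _ p1d1 p2d1) _; rewrite ler_wpM2l// ltW.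
have T2 : `|B (x1 - x2) (v1 - v)| <= b * dx * r.
  apply: le_trans (ler_norm_bop _ _) _; rewrite ler_pM//.
  by apply: le_trans (ler_norm_bop _ _) _; rewrite ler_wpM2r// lerDl.
have T3 : `|t *: B (v1 - v2) v1| <= r * (b * dv * N).
  rewrite normrZ ler_pM//; apply: le_trans (ler_norm_bop _ _) _.
  rewrite ler_pM ?wv//.
  by apply: le_trans (ler_norm_bop _ _) _; rewrite ler_wpM2r// lerDl.
have T4 : `|(f' p2 - f' x) (v1 - v2)| <= e1 * dv.
  apply: le_trans (ler_norm_bop _ _) _; rewrite ler_wpM2r//.
  exact: fd2.
rewrite (le_trans (ler_normD _ _))//.
rewrite (le_trans (lerD (ler_normD _ _) (lexx _)))//.
rewrite (le_trans (lerD (lerD (ler_normD _ _) (lexx _)) (lexx _)))//.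
apply: le_trans (lerD (lerD (lerD T1 T2) T3) T4) _.
have dx0 : 0 <= dx by exact: normr_ge0.
have dv0 : 0 <= dv by exact: normr_ge0.
have e1E : e1 * N = e / 4 by rewrite /e1; field; rewrite gt_eqF.
have e1le : e1 <= e / 4 by rewrite -e1E ler_peMr// ltW.
have rb0 : 0 <= r * b by rewrite mulr_ge0// ltW.
have rbN : r * b * N <= e / 2 by lra.
have rb : r * b <= e / 2 by apply: le_trans rbN; rewrite ler_peMr.
have -> : e1 * (dx + dv) * N + b * dx * r + r * (b * dv * N) + e1 * dv =
  e1 * N * (dx + dv) + r * b * dx + r * b * N * dv + e1 * dv by ring.
rewrite e1E; nra.
Qed.

End CentralDifferences.

(** * Second-order consistency of the central differences *)

Section CentralErrors.
Context {R : realType}.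
Implicit Types V W : normedModType R.

Lemma central_average_error V W (f : V -> W) (x v : V) : Ck 2 f ->
  exists C r, [/\ 0 <= C, 0 < r & forall h, 0 < h -> h <= r ->
    `|central_average f h x v - f x| <= C * h ^+ 2].
Proof.
move=> /(Ck2_symmetric_sum x v) [C [r [C0 r0 fC]]].
exists C, r; split=> // h h0 hr.
have h_r : `|h| <= r by rewrite ger0_norm// ltW.
apply: le_trans (fC h h_r).
rewrite (_ : central_average f h x v - f x
  = 2^-1 *: (f (x + h *: v) + f (x - h *: v) - 2 *: f x)).
  by rewrite normrZ ger0_norm ?invr_ge0// ler_piMl// invf_le1// ler1n.
by rewrite scalerBr scalerA mulVf// scale1r.
Qed.

(** In [t], the derivative of [f (x + t v) - f (x - t v) - 2 t f'(x) v] is a symmetric sum of [f'],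
    of size [O(t^2)]. Accumulating it up to [h] and dividing by [2 * h] leaves [O(h^2)]. *)
Lemma central_difference_error V W (f : V -> W) (x v : V) : Ck 3 f ->
  exists C r, [/\ 0 <= C, 0 < r & forall h, 0 < h -> h <= r ->
    `|central_difference f h x v - fderiv f x v| <= C * h ^+ 2].
Proof.
move=> [df /(Ck2_symmetric_sum x v) [C [r [C0 r0 fC]]]].
exists (C * `|v|), r; split=> // [|h h0 hr]; first exact: mulr_ge0.
pose g' (t : R) := fderiv f (x + t *: v) v - fderiv f (x + t *: (- v)) (- v)
  - 2 *: fderiv f x v.
have dg (t : R) : is_derive t 1
  (fun s : R => f (x + s *: v) - f (x + s *: (- v)) - s *: (2 *: fderiv f x v))
  (g' t).
  apply: is_deriveB; last exact: is_derive_scalel.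
  by apply: is_deriveB; exact: is_derive_line.
have g'M t : 0 <= t <= h -> `|g' t| <= C * h ^+ 2 * `|v|.
  move=> /andP[t0 th]; rewrite /g' linearN opprK scalerN.
  rewrite -[X in `|X|]/((fderiv f (x + t *: v) + fderiv f (x - t *: v)
    - 2 *: fderiv f x) v).
  apply: le_trans (ler_norm_bop _ _) _; rewrite ler_wpM2r//.
  apply: le_trans (fC t _) _; first by rewrite ger0_norm// (le_trans th).
  by rewrite ler_wpM2l// ler_sqr ?nnegrE// ltW.
have := mean_value_norm (ltW h0) (fun t _ => dg t) g'M.
rewrite !scale0r !addr0 !subr0 subrr subr0 scalerN => gh.
have h2 : 0 < (2 * h)^-1 by rewrite invr_gt0 mulr_gt0.
have -> : central_difference f h x v - fderiv f x v = (2 * h)^-1 *: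
    (f (x + h *: v) - f (x - h *: v) - h *: (2 *: fderiv f x v)).
  rewrite [RHS]scalerBr; congr (_ - _); rewrite !scalerA.
  rewrite (_ : _ * _ = 1) ?scale1r//.
  by field; rewrite gt_eqF.
rewrite normrZ gtr0_norm// mulrC ler_pdivrMr ?mulr_gt0//.
apply: le_trans gh _; rewrite [leRHS](_ : _ = 2 * (C * h ^+ 2 * `|v| * h)).
  by rewrite ler_peMl ?ler1n// !mulr_ge0 ?exprn_ge0// ltW.
by ring.
Qed.

End CentralErrors.

(** The ball is invariant since [|T z| <= q |z| + |T 0| <= q r + (1 - q) r]. *)
Lemma banach_closed_ball {R : realType} {Z : completeNormedModType R}
    (T : Z -> Z) (q r : R) : 0 <= q < 1 -> 0 <= r ->
    (forall z1 z2, `|z1| <= r -> `|z2| <= r ->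
      `|T z1 - T z2| <= q * `|z1 - z2|) ->
    `|T 0| <= (1 - q) * r ->
  exists2 z, `|z| <= r & T z = z.
Proof.
move=> /andP[q0 q1] r0 Tq T0; pose U := [set z : Z | `|z| <= r].
have TU : set_fun U U T.
  move=> z /= zr; rewrite /U /= -[T z](subrK (T 0)).
  rewrite (le_trans (ler_normD _ _))//.
  have := Tq z 0 zr; rewrite normr0 subr0 => /(_ r0) Tz.
  apply: le_trans (lerD Tz T0) _.
  by rewrite mulrBl mul1r addrCA gerDl subr_le0 ler_wpM2l.
pose f : {fun U >-> U} := HB.pack T (isFun.Build _ _ _ _ _ TU).
have [|||z zr fz] := @banach_fixed_point _ _ U f; last by exists z.
- exists (NngNum q0); split=> //= -[x y] [xr yr]; exact: Tq.
- apply: (@closed_comp _ _ (fun z : Z => `|z|) [set x | x <= r]).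
    by move=> z _; exact: norm_continuous.
  exact: closed_le.
- by exists 0; rewrite /U /= normr0.
Qed.

(** * The preconditioned linearization at a saddle *)

Section Preconditioner.
Context {R : realType} {X : completeNormedModType R}.
Variable dot : {dot X for idfun}.
Hypothesis dot_norm : forall x : X, `|x| ^+ 2 = dot x x.

(** Expand the square of [w - tau u]: coercivity bounds the cross term from below and [K] bounds
    [u]. The shift [s] serves both [A], with [s = 0], and [A - l], with [s = - l]. *)
Lemma damped_contraction (A : bop X X) (v : X) (s mu : R) : 0 < mu -> 0 <= s ->
    (forall w, dot w v = 0 -> mu * `|w| ^+ 2 <= dot w (A w)) ->
  exists tau rho, [/\ 0 < tau, 0 <= rho < 1 & forall w, dot w v = 0 ->
    `|w - tau *: (A w + s *: w)| <= rho * `|w|].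
Proof.
move=> mu0 s0 Amu; pose K := `|A| + s + mu.
have K0 : 0 < K by rewrite ltr_wpDl ?addr_ge0.
have muK : mu / K <= 1 by rewrite ler_pdivrMr// mul1r lerDr addr_ge0.
have muK0 : 0 < mu / K by rewrite divr_gt0.
(* This [tau] minimizes [1 - 2 tau mu + tau^2 K^2], with minimum [1 - (mu / K)^2]; [rho] bounds its
   square root. Including [mu] in [K] keeps [rho] nonnegative. *)
exists (mu / K ^+ 2), (1 - (mu / K) ^+ 2 / 2); split.
- by rewrite divr_gt0// exprn_gt0.
- apply/andP; split; last by rewrite ltrBlDr ltrDl divr_gt0// exprn_gt0.
  nra.
move=> w wv; set u := A w + s *: w.
have uK : `|u| <= K * `|w|.
  rewrite (le_trans (ler_normD _ _))// normrZ ger0_norm// /K mulrDl mulrDl.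
  by rewrite -addrA lerD ?ler_norm_bop// lerDl mulr_ge0// ltW.
have wu : mu * `|w| ^+ 2 <= dot w u.
  rewrite dotDr dotZr -dot_norm; apply: le_trans (Amu w wv) _.
  by rewrite lerDl mulr_ge0// exprn_ge0.
rewrite -ler_sqr ?nnegrE//; last first.
  rewrite mulr_ge0//; nra.
rewrite (normB_sqr dot_norm) dotZr normrZ ger0_norm; last first.
  by rewrite divr_ge0 ?exprn_ge0// ltW.
have u2 : `|u| ^+ 2 <= K ^+ 2 * `|w| ^+ 2.
  by rewrite -exprMn ler_sqr ?nnegrE// mulr_ge0// ltW.
have t0 : 0 <= mu / K ^+ 2 by rewrite divr_ge0 ?exprn_ge0// ltW.
have tE : mu / K ^+ 2 * mu = (mu / K) ^+ 2 by field; rewrite gt_eqF.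
have tE2 : (mu / K ^+ 2) ^+ 2 * K ^+ 2 = (mu / K) ^+ 2 by field; rewrite gt_eqF.
have h1 : (mu / K) ^+ 2 * `|w| ^+ 2 <= mu / K ^+ 2 * dot w u.
  by rewrite -tE -mulrA ler_wpM2l.
have h2 : (mu / K ^+ 2) ^+ 2 * `|u| ^+ 2 <= (mu / K) ^+ 2 * `|w| ^+ 2.
  by rewrite -tE2 -mulrA ler_wpM2l// sqr_ge0.
rewrite [(_ * `|u|) ^+ 2]exprMn [(_ * `|w|) ^+ 2]exprMn.
have : 0 <= ((mu / K) ^+ 2 / 2) ^+ 2 * `|w| ^+ 2.
  by rewrite mulr_ge0 ?sqr_ge0.
by move: h1 h2; set x := (mu / K) ^+ 2; set n := `|w| ^+ 2 => *; lra.
Qed.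

Variables (A : bop X X) (v : X) (l : R).
Hypothesis A_sym : self_adjoint dot A.
Hypothesis Av : A v = l *: v.
Hypothesis v1 : `|v| = 1.
Hypothesis l0 : l < 0.

Definition orthproj (w : X) : X := w - dot v w *: v.

(* An approximate inverse of A: a damped step on the orthogonal complement of v,
   exact on the line of v. *)
Definition precond (tau : R) (w : X) : X :=
  tau *: orthproj w + (l^-1 * dot v w) *: v.

Lemma dotvv : dot v v = 1.
Proof. by rewrite -dot_norm v1 expr1n. Qed.

Lemma orthprojD u w : orthproj (u + w) = orthproj u + orthproj w.
Proof. by rewrite /orthproj dotDr scalerDl opprD addrACA. Qed.

Lemma orthprojZ a w : orthproj (a *: w) = a *: orthproj w.
Proof. by rewrite /orthproj dotZr -scalerA scalerBr. Qed.

Lemma orthprojB u w : orthproj (u - w) = orthproj u - orthproj w.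
Proof. by rewrite orthprojD -scaleN1r orthprojZ scaleN1r. Qed.

Lemma orthproj_v : orthproj v = 0.
Proof. by rewrite /orthproj dotvv scale1r subrr. Qed.

Lemma dot_orthproj w : dot (orthproj w) v = 0.
Proof. by rewrite dotBl dotZl dotvv mulr1 (dotC dot w) subrr. Qed.

Lemma norm_orthproj w : `|orthproj w| <= `|w|.
Proof.
rewrite -ler_sqr ?nnegrE// (normB_sqr dot_norm) dotZr (dotC dot w).
rewrite normrZ v1 mulr1.
by rewrite (real_normK (num_real _)); nra.
Qed.

Lemma dot_eigen w : dot v (A w) = l * dot v w.
Proof. by rewrite -A_sym Av dotZl. Qed.

(** Symmetry makes the orthogonal complement of an eigenvector invariant. *)
Lemma orthproj_A w : orthproj (A w) = A (orthproj w).
Proof.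
have AE a : A (w - a *: v) = A w - a *: A v by rewrite linearB linearZ.
by rewrite /orthproj AE dot_eigen Av scalerA mulrC.
Qed.

Lemma norm_dot_v w : `|dot v w| <= `|w|.
Proof. by apply: le_trans (dot_le_norm dot_norm _ _) _; rewrite v1 mul1r. Qed.

Lemma precondD tau u w : precond tau (u + w) = precond tau u + precond tau w.
Proof.
by rewrite /precond orthprojD scalerDr dotDr mulrDr scalerDl addrACA.
Qed.

Lemma precondZ tau a w : precond tau (a *: w) = a *: precond tau w.
Proof.
rewrite /precond orthprojZ dotZr [RHS]scalerDr !scalerA.
by rewrite (mulrC tau) (mulrCA l^-1).
Qed.

Lemma precondB tau u w : precond tau (u - w) = precond tau u - precond tau w.
Proof. by rewrite precondD -scaleN1r precondZ scaleN1r. Qed.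

Lemma norm_precond tau w : 0 < tau ->
  `|precond tau w| <= (tau + `|l^-1|) * `|w|.
Proof.
move=> t0; apply: le_trans (ler_normD _ _) _; rewrite !normrZ v1 mulr1 ?normrM.
rewrite gtr0_norm// mulrDl lerD//.
  by rewrite ler_pM2l// norm_orthproj.
by rewrite ler_wpM2l// norm_dot_v.
Qed.

(** Pairing with [v] separates the two orthogonal summands. This lets one vector update encode both
    the projected eigenvector equation and the normalization. *)
Lemma orthproj_eq0 tau s w : tau != 0 ->
  tau *: orthproj w + s *: v = 0 -> orthproj w = 0 /\ s = 0.
Proof.
move=> t0 E; have s0 : s = 0.
  have := congr1 (dot v) E.
  rewrite dotDr !dotZr (dotC dot v (orthproj w)) dot_orthproj.
  by rewrite mulr0 add0r dotvv mulr1 linear0r.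
split=> //; move: E; rewrite s0 scale0r addr0 => /eqP.
by rewrite scaler_eq0 (negbTE t0) => /eqP.
Qed.

Lemma orthproj_dot_eq0 w : orthproj w = 0 -> dot v w = 0 -> w = 0.
Proof. by rewrite /orthproj => + vw; rewrite vw scale0r subr0. Qed.

(** Injectivity is what makes fixed points genuine zeros, although [precond] inverts [A] only
    approximately. *)
Lemma precond_eq0 tau w : tau != 0 -> precond tau w = 0 -> w = 0.
Proof.
move=> t0 /orthproj_eq0 [] // Pw /eqP.
rewrite mulf_eq0 invr_eq0 lt_eqF//= => /eqP.
exact: orthproj_dot_eq0.
Qed.

Variables (tau1 rho1 tau2 rho2 : R).
Hypothesis tau10 : 0 < tau1.
Hypothesis tau20 : 0 < tau2.
Hypothesis rho10 : 0 <= rho1.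
Hypothesis rho20 : 0 <= rho2.
Hypothesis contr1 : forall w, dot w v = 0 ->
  `|w - tau1 *: A w| <= rho1 * `|w|.
Hypothesis contr2 : forall w, dot w v = 0 ->
  `|w - tau2 *: (A w - l *: w)| <= rho2 * `|w|.

(** If [f] were exactly [sigma *: A y], the component along [v] would be removed entirely and the
    rest contracted by [rho1]; the defect [e] passes through the bounded [precond]. *)
Lemma step_x (sigma : R) (y f : X) : 0 < sigma ->
  `|y - sigma^-1 *: precond tau1 f| <=
  rho1 * `|y| + sigma^-1 * (tau1 + `|l^-1|) * `|f - sigma *: A y|.
Proof.
move=> s0; set e := f - _.
have -> : f = sigma *: A y + e by rewrite addrC subrK.
rewrite precondD precondZ scalerDr scalerA mulVf ?gt_eqF// scale1r opprD addrA.
apply: le_trans (ler_normB _ _) _; apply: lerD.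
  rewrite (_ : y - _ = orthproj y - tau1 *: A (orthproj y)).
    apply: le_trans (contr1 (dot_orthproj y)) _.
    by rewrite ler_wpM2l// norm_orthproj.
  rewrite /precond orthproj_A dot_eigen mulrA mulVf ?lt_eqF// mul1r.
  by rewrite [in RHS]/orthproj opprD addrA addrAC.
rewrite normrZ gtr0_norm ?invr_gt0// -mulrA ler_pM2l ?invr_gt0//.
exact: norm_precond.
Qed.

(** Projection removes the unknown [m], leaving a damped step for [A - l]; the component of [w]
    along [v] is corrected by the normalization residual [g]. *)
Lemma step_v (w f : X) (m g : R) :
  `|w - tau2 *: orthproj f - g *: v| <=
  rho2 * `|w| + tau2 * `|f - (A w - l *: w - m *: v)| + `|g - dot v w|.
Proof.
set e := f - _.
have -> : f = (A w - l *: w - m *: v) + e by rewrite addrC subrK.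
have PE : orthproj (A w - l *: w - m *: v) = A (orthproj w) - l *: orthproj w.
  rewrite -!scaleNr !orthprojD !orthprojZ orthproj_v scaler0 addr0 orthproj_A.
  by rewrite scaleNr.
rewrite orthprojD PE.
set u := A _ - _.
have -> : w - tau2 *: (u + orthproj e) - g *: v =
    (orthproj w - tau2 *: u) - tau2 *: orthproj e - (g - dot v w) *: v.
  rewrite scalerBl /orthproj scalerDr opprD opprB !addrA.
  set b := dot v w *: v; set d := tau2 *: (e - _).
  by rewrite (addrAC _ (- d) b) (addrAC _ (- (tau2 *: u)) b) subrK.
apply: le_trans (ler_normB _ _) _; apply: lerD; last by rewrite normrZ v1 mulr1.
apply: le_trans (ler_normB _ _) _; apply: lerD.
  apply: le_trans (contr2 (dot_orthproj w)) _.
  by rewrite ler_wpM2l// norm_orthproj.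
by rewrite normrZ gtr0_norm// ler_pM2l// norm_orthproj.
Qed.

(** By symmetry [v] is orthogonal to [A w - l *: w], so pairing [f] with [v] recovers [- m] up to
    the defect. *)
Lemma step_l (w f : X) (m : R) :
  `|m + dot v f| <= `|f - (A w - l *: w - m *: v)|.
Proof.
apply: le_trans (norm_dot_v _).
by rewrite !dotBr !dotZr dot_eigen subrr sub0r dotvv mulr1 opprK addrC.
Qed.

End Preconditioner.

(** * The fixed point *)

Section ProductComplete.
Context {R : realType} {U V : completeNormedModType R}.

HB.instance Definition _ := Pointed.on (U * V)%type.

(** Both projections of a Cauchy filter are Cauchy. The instance built on this makes [X * X * R] a
    complete space for the fixed point theorem. *)
Lemma prod_complete (F : set_system (U * V)) :
  ProperFilter F -> cauchy F -> cvg F.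
Proof.
move=> FF /cauchyP Fc.
have /cauchy_cvg/cvg_ex[u Fu] : cauchy (fst @ F).
  apply: cauchy_exP => e e0; have [z Fz] := Fc e e0; exists z.1.
  apply: (@filterS _ F _ (ball z e)) Fz => y zy; rewrite /preimage /=.
  by have [] : ball z.1 e y.1 /\ ball z.2 e y.2 by exact: zy.
have /cauchy_cvg/cvg_ex[v Fv] : cauchy (snd @ F).
  apply: cauchy_exP => e e0; have [z Fz] := Fc e e0; exists z.2.
  apply: (@filterS _ F _ (ball z e)) Fz => y zy; rewrite /preimage /=.
  by have [] : ball z.1 e y.1 /\ ball z.2 e y.2 by exact: zy.
apply/cvg_ex; exists (u, v) => A uvA.
have FA : F ((fun x => (x.1, x.2)) @^-1` A) by exact: cvg_pair Fu Fv _ uvA.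
by apply: (@filterS _ F _ _ A _ FA) => -[].
Qed.

HB.instance Definition _ := Uniform_isComplete.Build (U * V)%type prod_complete.

End ProductComplete.

Lemma prod3_norm_le {R : realType} {U V W : normedModType R} (u : U) (v : V)
  (w : W) (M : R) :
  (`|(u, v, w)| <= M) = [&& `|u| <= M, `|v| <= M & `|w| <= M].
Proof. by rewrite !prod_normE/= !ge_max andbA. Qed.

Section Continuation.
Context {R : realType} {X : completeNormedModType R}.
Variable dot : {dot X for idfun}.
Hypothesis dot_norm : forall x : X, `|x| ^+ 2 = dot x x.

(** After removal of the linear part only half of [|w1|^2 - |w2|^2] remains, which factors. *)
Lemma half_norm_strict (v w1 w2 : X) (r : R) : `|w1| <= r -> `|w2| <= r ->
  `|2^-1 * (`|v + w1| ^+ 2 - 1) - 2^-1 * (`|v + w2| ^+ 2 - 1)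
    - dot v (w1 - w2)| <= r * `|w1 - w2|.
Proof.
move=> w1r w2r; rewrite !(normD_sqr dot_norm) dotBr.
rewrite (_ : _ - _ = 2^-1 * (`|w1| + `|w2|) * (`|w1| - `|w2|)); last by field.
rewrite normrM ger0_norm ?mulr_ge0 ?addr_ge0 ?invr_ge0//.
by rewrite ler_pM ?ler_dist_dist ?mulr_ge0 ?addr_ge0 ?invr_ge0//; lra.
Qed.

(** Here [a] stands for the increment of [A] in [w] and [b] for the coupling to [x]. The product of
    eigenvalue and vector adds [m1 *: (w1 - w2) + (m1 - m2) *: w2]. *)
Lemma eigen_residual_strict (d1 d2 a b v w1 w2 : X) (l m1 m2 r e : R) :
    `|m1| <= r -> `|w2| <= r -> `|d1 - d2 - (b + a)| <= e ->
  `|(d1 - (l + m1) *: (v + w1)) - (d2 - (l + m2) *: (v + w2))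
    - (a - l *: (w1 - w2) - (m1 - m2) *: v)|
  <= e + `|b| + (r * `|w1 - w2| + r * `|m1 - m2|).
Proof.
move=> m1r w2r de.
rewrite (_ : _ - _ - _ = (d1 - d2 - (b + a)) + b
    - (m1 *: (w1 - w2) + (m1 - m2) *: w2)); last first.
  (* Testing against an arbitrary u lets ring prove an identity of vectors. *)
  apply: (dot_inj dot_norm) => u.
  rewrite !(dotDl, dotNl, dotZl); ring.
apply: le_trans (ler_normB _ _) _; apply: lerD.
  by apply: le_trans (ler_normD _ _) _; rewrite lerD2r.
apply: le_trans (ler_normD _ _) _; rewrite !normrZ.
by rewrite lerD ?ler_wpM2r// mulrC ler_wpM2r.
Qed.

Lemma saddle_continuation (G : X -> X) (xs v : X) (l mu : R) :
    Ck 3 G -> G xs = 0 -> self_adjoint dot (fderiv G xs) ->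
    fderiv G xs v = l *: v -> `|v| = 1 -> l < 0 -> 0 < mu ->
    (forall w, dot w v = 0 -> mu * `|w| ^+ 2 <= dot w (fderiv G xs w)) ->
  exists h0 C : R, 0 < h0 /\ forall h, 0 < h -> h <= h0 ->
    exists x w lam, [/\ central_average G h x w = 0,
      central_difference G h x w = lam *: w, `|w| = 1 &
      `|x - xs| + `|w - v| + `|lam - l| <= C * h ^+ 2].
Proof.
move=> CG Gxs A_sym Av v1 l0 mu0 Amu; pose A := fderiv G xs.
pose B := fderiv (fderiv G) xs.
have [t1 [rho1 [t10 /andP[rho10 rho11] contr1]]] :=
  damped_contraction dot_norm mu0 (lexx 0) Amu.
have nl0 : 0 <= - l by rewrite oppr_ge0 ltW.
have [t2 [rho2 [t20 /andP[rho20 rho21] contr2]]] :=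
  damped_contraction dot_norm mu0 nl0 Amu.
have {}contr1 w : dot w v = 0 -> `|w - t1 *: A w| <= rho1 * `|w|.
  by move=> /contr1; rewrite scale0r addr0.
have {}contr2 w : dot w v = 0 -> `|w - t2 *: (A w - l *: w)| <= rho2 * `|w|.
  by move=> /contr2; rewrite scaleNr.
have [rho [rho_lt1 rho1_le rho2_le]] :
    exists rho, [/\ rho < 1, rho1 <= rho & rho2 <= rho].
  exists (Num.max rho1 rho2).
  by rewrite gt_max rho11 rho21 !le_max !lexx orbT.
have rho_ge0 : 0 <= rho := le_trans rho10 rho1_le.
(* A quarter of the contraction margin: the perturbations of each component will use at most two
   quarters, leaving the factor [1 - gam]. *)
pose gam := (1 - rho) / 4.
have gam0 : 0 < gam by rewrite divr_gt0// subr_gt0.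
have gam4 : 4 * gam = 1 - rho by rewrite mulrC divfK.
(* With x = xs + sig *: y, the coupling of the eigenvector equation to y has
   size at most gam. *)
have [sig [sig0 sig1 sigB sigBt]] : exists sig, [/\ 0 < sig, sig <= 1,
    sig * `|B| <= gam & t2 * (sig * `|B|) <= gam].
  have B1 : 0 < `|B| + 1 by rewrite ltr_wpDl.
  have t21 : 0 < t2 + 1 by rewrite addr_gt0.
  exists (Num.min 1 (gam / ((`|B| + 1) * (t2 + 1)))).
  set sig := Num.min _ _.
  have sig0 : 0 < sig by rewrite lt_min ltr01 divr_gt0// mulr_gt0.
  have H1 : sig * ((`|B| + 1) * (t2 + 1)) <= gam.
    by rewrite -ler_pdivlMr ?mulr_gt0// ge_min lexx orbT.
  have H2 := ltW sig0; have H3 := mulr_ge0 (ltW sig0) (normr_ge0 B).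
  have H4 := mulr_ge0 (ltW sig0) (ltW t20); have H5 := mulr_ge0 (ltW t20) H3.
  split=> //; first by rewrite ge_min lexx.
    by move: H1 H2 H3 H4 H5; clear; lra.
  by move: H1 H2 H3 H4 H5; clear; lra.
pose kR := t1 + `|l^-1|.
have kR0 : 0 < kR by rewrite ltr_pwDl.
(* Amplification by [sig^-1 * kR] turns the averaging error [e1 * (2 * d)] into [gam * d]. *)
pose e1 := sig * gam / (2 * kR).
have e10 : 0 < e1 by rewrite divr_gt0// mulr_gt0.
have e1E : sig^-1 * kR * (2 * e1) = gam by rewrite /e1; field; rewrite !gt_eqF.
(* Of the four [e2], two come from the central difference and two from the product of eigenvalue and
   vector. The factor [t2 + 1] covers the step [t2] and one further [e2] from the normalization. *)
pose e2 := gam / (4 * (t2 + 1)).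
have t21 : 0 < t2 + 1 by rewrite addr_gt0.
have e20 : 0 < e2 by rewrite divr_gt0// mulr_gt0.
have e2E : (t2 + 1) * (4 * e2) = gam by rewrite /e2; field; rewrite gt_eqF.
have C2G := CkS CG; have C1G := CkS C2G.
have [ra ra0 avg_strict] := central_average_strict xs v C1G e10.
have [rb rb0 diff_strict] := central_difference_strict xs v C2G e20.
have [C1 [rc [C10 rc0 avg_err]]] := central_average_error xs v C2G.
have [C2 [rd [C20 rd0 diff_err]]] := central_difference_error xs v CG.
have [r [r0 r_ra r_rb r_e2]] :
    exists r, [/\ 0 < r, r <= ra, r <= rb & r <= e2].
  exists (Num.min ra (Num.min rb e2)).
  by rewrite !lt_min ra0 rb0 e20 !ge_min !lexx !orbT.
(* [CT * h ^+ 2] bounds [|T 0|], the preconditioned residual at the saddle; dividing by [gam] gives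
   the radius that [banach_closed_ball] asks for. *)
pose CT := sig^-1 * kR * C1 + (t2 + 1) * C2.
have CT0 : 0 <= CT.
  by rewrite addr_ge0// mulr_ge0// ?mulr_ge0// ?invr_ge0// ltW.
pose CC := CT / gam.
have CC0 : 0 <= CC by rewrite divr_ge0// ltW.
have [h0 [h00 h01 h0r h0rc h0rd] h0CC] : exists2 h0, [/\ 0 < h0, h0 <= 1,
    h0 <= r, h0 <= rc & h0 <= rd] & h0 * CC <= r.
  exists (Num.min 1 (Num.min r (Num.min rc (Num.min rd (r / (CC + 1)))))).
    rewrite !lt_min ltr01 r0 rc0 rd0 divr_gt0 ?ltr_wpDl//.
    by rewrite !ge_min !lexx !orbT.
  set h0 := Num.min _ _.
  have h0r : h0 * (CC + 1) <= r.
    by rewrite -ler_pdivlMr ?ltr_wpDl// !ge_min !lexx !orbT.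
  have h00 : 0 < h0.
    by rewrite !lt_min ltr01 r0 rc0 rd0 divr_gt0 ?ltr_wpDl.
  by apply: le_trans h0r; rewrite ler_wpM2l ?(ltW h00)// lerDl.
(* Each of the three offsets is at most [CC * h ^+ 2], as the product carries the maximum norm. *)
exists h0, (3 * CC); split=> // h hgt0 h_le.
pose f1 (z : X * X * R) : X :=
  central_average G h (xs + sig *: z.1.1) (v + z.1.2).
pose f2 (z : X * X * R) : X :=
  central_difference G h (xs + sig *: z.1.1) (v + z.1.2)
  - (l + z.2) *: (v + z.1.2).
pose f3 (z : X * X * R) : R := 2^-1 * (`|v + z.1.2| ^+ 2 - 1).
(* The offsets from the saddle are [(sig *: y, w, m)]. The last sign is a plus because the
   eigenvector residual has derivative [- v] in [m]. *)
pose T (z : X * X * R) : X * X * R :=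
  (z.1.1 - sig^-1 *: precond dot v l t1 (f1 z),
   z.1.2 - t2 *: orthproj dot v (f2 z) - f3 z *: v,
   z.2 + dot v (f2 z)).
have Tcontr z1 z2 : `|z1| <= r -> `|z2| <= r ->
    `|T z1 - T z2| <= (1 - gam) * `|z1 - z2|.
  case: z1 z2 => [[y1 w1] m1] [[y2 w2] m2].
  have subrACA (a b c e : X) : a - b - (c - e) = a - c - (b - e).
    by rewrite opprD addrACA -opprD.
  rewrite !prod3_norm_le => /and3P[y1r w1r m1r] /and3P[y2r w2r m2r].
  set d := `|(y1, w1, m1) - (y2, w2, m2)|.
  have : `|(y1 - y2, w1 - w2, m1 - m2)| <= d by [].
  rewrite prod3_norm_le => /and3P[yd wd md].
  have d0 : 0 <= d by exact: le_trans yd.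
  have xE : xs + sig *: y1 - (xs + sig *: y2) = sig *: (y1 - y2).
    by rewrite opprD addrACA subrr add0r scalerBr.
  have vE : v + w1 - (v + w2) = w1 - w2 by rewrite opprD addrACA subrr add0r.
  have near_x y r' : `|y| <= r -> r <= r' -> `|xs + sig *: y - xs| <= r'.
    move=> yr rr'; rewrite addrAC subrr add0r normrZ gtr0_norm//.
    by apply: le_trans rr'; apply: le_trans yr; rewrite ler_piMl.
  have near_v w r' : `|w| <= r -> r <= r' -> `|v + w - v| <= r'.
    by move=> wr rr'; rewrite addrAC subrr add0r; exact: le_trans rr'.
  have sd : `|sig *: (y1 - y2)| + `|w1 - w2| <= 2 * d.
    rewrite normrZ gtr0_norm// mulr2n mulrDl mul1r lerD//.
    by apply: le_trans yd; rewrite ler_piMl.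
  have E1 : `|f1 (y1, w1, m1) - f1 (y2, w2, m2) - sig *: A (y1 - y2)|
      <= e1 * (2 * d).
    have := avg_strict h _ _ _ _ hgt0 (le_trans (le_trans h_le h0r) r_ra)
      (near_x _ _ y1r r_ra) (near_x _ _ y2r r_ra)
      (near_v _ _ w1r r_ra) (near_v _ _ w2r r_ra).
    have AZ : A (sig *: (y1 - y2)) = sig *: A (y1 - y2) by exact: linearZ.
    rewrite xE vE -/A AZ => E1; apply: le_trans E1 _.
    by rewrite ler_wpM2l// ltW.
  have E2 : `|f2 (y1, w1, m1) - f2 (y2, w2, m2)
      - (A (w1 - w2) - l *: (w1 - w2) - (m1 - m2) *: v)|
      <= (sig * `|B| + 4 * e2) * d.
    have := diff_strict h _ _ _ _ hgt0 (le_trans (le_trans h_le h0r) r_rb)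
      (near_x _ _ y1r r_rb) (near_x _ _ y2r r_rb)
      (near_v _ _ w1r r_rb) (near_v _ _ w2r r_rb).
    rewrite xE vE => E2.
    apply: le_trans (eigen_residual_strict v w1 l m2 m1r w2r E2) _.
    have bB : `|B (sig *: (y1 - y2)) v| <= sig * `|B| * d.
      apply: le_trans (ler_norm_bop _ _) _; rewrite v1 mulr1.
      apply: le_trans (ler_norm_bop _ _) _; rewrite normrZ gtr0_norm//.
      by rewrite mulrCA mulrA ler_wpM2l// mulr_ge0// ltW.
    have e2d := ler_wpM2l (ltW e20) sd.
    have rw : r * `|w1 - w2| <= e2 * d by rewrite ler_pM// ltW.
    have rm : r * `|m1 - m2| <= e2 * d by rewrite ler_pM// ltW.
    by move: bB e2d rw rm; rewrite -/B; clear=> *; lra.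
  have E3 : `|f3 (y1, w1, m1) - f3 (y2, w2, m2) - dot v (w1 - w2)| <= r * d.
    apply: le_trans (half_norm_strict v w1r w2r) _.
    by rewrite ler_wpM2l// ltW.
  have S1 := step_x dot_norm A_sym Av v1 l0 t10 rho10 contr1 (y1 - y2)
    (f1 (y1, w1, m1) - f1 (y2, w2, m2)) sig0.
  have S2 := step_v dot_norm A_sym Av v1 t20 rho20 contr2 (w1 - w2)
    (f2 (y1, w1, m1) - f2 (y2, w2, m2)) (m1 - m2)
    (f3 (y1, w1, m1) - f3 (y2, w2, m2)).
  have S3 := step_l dot_norm A_sym Av v1 (w1 - w2)
    (f2 (y1, w1, m1) - f2 (y2, w2, m2)) (m1 - m2).
  have rd1 : rho1 * `|y1 - y2| <= rho * d by rewrite ler_pM.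
  have rd2 : rho2 * `|w1 - w2| <= rho * d by rewrite ler_pM.
  have {}E1 : sig^-1 * kR * `|f1 (y1, w1, m1) - f1 (y2, w2, m2)
      - sig *: A (y1 - y2)| <= gam * d.
    rewrite -e1E -[leRHS]mulrA ler_wpM2l//.
      by rewrite mulr_ge0 ?invr_ge0 ?(ltW sig0) ?(ltW kR0).
    by move: E1; rewrite mulrCA mulrA.
  have tE2 := ler_wpM2l (ltW t20) E2.
  have sBd := ler_wpM2r d0 sigB; have sBtd := ler_wpM2r d0 sigBt.
  have re2d := ler_wpM2r d0 r_e2.
  have e2d : 0 <= e2 * d by rewrite mulr_ge0// ltW.
  have te2d : 0 <= t2 * (e2 * d) by rewrite mulr_ge0// ltW.
  have e2Ed : (t2 + 1) * (4 * e2) * d = gam * d by rewrite e2E.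
  have gam4d : 4 * gam * d = (1 - rho) * d by rewrite gam4.
  have rhod : 0 <= rho * d by rewrite mulr_ge0.
  have gamd : 0 <= gam * d by rewrite mulr_ge0// ltW.
  (* The [y] and [w] components have linear factor at most [rho], which is [1 - 4 * gam], plus
     errors of at most [2 * gam]. The [m] component is pure error, and [2 * gam <= 1 - gam] since
     [4 * gam <= 1]. *)
  apply/and3P; split.
  - rewrite [X in `|X|](_ : _ = y1 - y2 - sig^-1 *: precond dot v l t1
      (f1 (y1, w1, m1) - f1 (y2, w2, m2))).
      apply: le_trans S1 _; move: rd1 E1 gam4d gamd.
      by rewrite -/A -/kR; clear=> *; lra.
    by rewrite precondB scalerBr subrACA.
  - rewrite [X in `|X|](_ : _ = w1 - w2 - t2 *: orthproj dot v
      (f2 (y1, w1, m1) - f2 (y2, w2, m2))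
      - (f3 (y1, w1, m1) - f3 (y2, w2, m2)) *: v).
      apply: le_trans S2 _; move: rd2 tE2 E3 sBtd re2d e2d te2d e2Ed gam4d gamd.
      by rewrite -/A; clear=> *; lra.
    rewrite orthprojB scalerBr scalerBl /T/=.
    by rewrite subrACA [X in X - _]subrACA.
  - rewrite [X in `|X|](_ : _ = m1 - m2 + dot v
      (f2 (y1, w1, m1) - f2 (y2, w2, m2))).
      apply: le_trans S3 _; apply: le_trans E2 _.
      move: sBd re2d e2d te2d e2Ed gam4d d0 rhod gamd.
      by clear=> *; lra.
    by rewrite dotBr /T/= opprD addrACA.
have T0 : `|T 0| <= (1 - (1 - gam)) * (CC * h ^+ 2).
  have h_rc := le_trans h_le h0rc; have h_rd := le_trans h_le h0rd.
  have := avg_err h hgt0 h_rc; rewrite Gxs subr0 => F1.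
  have := diff_err h hgt0 h_rd; rewrite Av => F2.
  have -> : (1 - (1 - gam)) * (CC * h ^+ 2) = CT * h ^+ 2.
    by rewrite /CC; field; rewrite gt_eqF.
  rewrite /T /f1 /f2 /f3 /= scaler0 !addr0 v1 expr1n subrr mulr0 scale0r subr0.
  rewrite !sub0r add0r.
  have h2 : 0 <= h ^+ 2 by rewrite exprn_ge0// ltW.
  have CTE : CT * h ^+ 2 = sig^-1 * kR * (C1 * h ^+ 2)
      + (t2 * (C2 * h ^+ 2) + C2 * h ^+ 2) by rewrite /CT; ring.
  have C1h : 0 <= sig^-1 * kR * (C1 * h ^+ 2).
    by rewrite !mulr_ge0 ?invr_ge0// ltW.
  have C2h : 0 <= C2 * h ^+ 2 by rewrite mulr_ge0.
  have tC2h : 0 <= t2 * (C2 * h ^+ 2) by rewrite mulr_ge0// ltW.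
  have S1 : sig^-1 * `|precond dot v l t1 (central_average G h xs v)|
      <= sig^-1 * kR * (C1 * h ^+ 2).
    rewrite -mulrA ler_wpM2l ?invr_ge0 ?(ltW sig0)//.
    apply: le_trans (norm_precond dot_norm l v1 _ t10) _.
    by rewrite ler_wpM2l// (ltW kR0).
  have S2 : t2 * `|orthproj dot v (central_difference G h xs v - l *: v)|
      <= t2 * (C2 * h ^+ 2).
    rewrite ler_wpM2l ?(ltW t20)//.
    exact: le_trans (norm_orthproj dot_norm v1 _) F2.
  have S3 : `|dot v (central_difference G h xs v - l *: v)| <= C2 * h ^+ 2.
    exact: le_trans (norm_dot_v dot_norm v1 _) F2.
  rewrite prod3_norm_le !normrN !normrZ (gtr0_norm t20) CTE.
  rewrite [`|sig^-1|]gtr0_norm ?invr_gt0//.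
  move: S1 S2 S3 C1h tC2h C2h; clear=> S1 S2 S3 C1h tC2h C2h.
  by apply/and3P; split; lra.
have rh : CC * h ^+ 2 <= r.
  apply: le_trans h0CC; rewrite mulrC ler_wpM2r// expr2.
  by rewrite -[leRHS]mulr1 ler_pM// ?(ltW hgt0)// (le_trans h_le).
have [||z1 z2 z1r z2r||[[y w] m]] :=
  @banach_closed_ball _ _ T (1 - gam) (CC * h ^+ 2).
- by move: gam4 gam0 rho_ge0; clear=> *; apply/andP; split; lra.
- by rewrite mulr_ge0// exprn_ge0// ltW.
- by apply: Tcontr; [exact: le_trans z1r rh|exact: le_trans z2r rh].
- exact: T0.
rewrite prod3_norm_le => /and3P[yr wr mr] [Ty Tw Tm].
have F1 : f1 (y, w, m) = 0.
  apply: (precond_eq0 dot_norm v1 l0 (lt0r_neq0 t10)).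
  move/eqP: Ty; rewrite -subr_eq0 addrAC subrr add0r oppr_eq0 scaler_eq0.
  by rewrite invr_eq0 gt_eqF//= => /eqP.
(* The [w] update gives the normalization and kills the projection of [f2]; the [m] update kills its
   component along [v]. *)
have [F2 F3] : f2 (y, w, m) = 0 /\ f3 (y, w, m) = 0.
  have [|Pf2 f30] := orthproj_eq0 dot_norm v1 (lt0r_neq0 t20)
      (w := f2 (y, w, m)) (s := f3 (y, w, m)).
    move/eqP: Tw; rewrite -subr_eq0 addrAC [_ - _ - w]addrAC subrr add0r.
    by rewrite -opprD oppr_eq0 => /eqP.
  split=> //; apply: (orthproj_dot_eq0 Pf2).
  by move/eqP: Tm; rewrite -subr_eq0 addrAC subrr add0r => /eqP.
exists (xs + sig *: y), (v + w), (l + m); split=> //.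
- by apply/eqP; rewrite -subr_eq0; apply/eqP.
- move/eqP: F3; rewrite /f3 mulf_eq0 invr_eq0 pnatr_eq0/= subr_eq0 => /eqP vw.
  by apply/eqP; rewrite -(eqrXn2 (n := 2)) ?expr1n ?vw.
- rewrite ![_ + _ - _]addrAC !subrr !add0r normrZ gtr0_norm//.
  have := ler_piMl (normr_ge0 y) sig1; move: yr wr mr; clear=> *; lra.
Qed.

End Continuation.

(** * Application to the gradient of [E] *)

Theorem proposition2p2 (R : realType) (X : completeNormedModType R)
    (dot : {dot X for idfun})
    (dot_norm : forall x : X, `|x| ^+ 2 = dot x x)
    (E : X -> R) (E_C4 : Ck 4 E)
    (xs vs : X) (ls : R) (saddle : index1_saddle dot E xs vs ls) :
  exists h0 C : R, 0 < h0 /\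
    forall h : R, 0 < h -> h <= h0 ->
      exists (xh vh : X) (lh : R),
        [/\ 2^-1 *: (grad dot E (xh + h *: vh) + grad dot E (xh - h *: vh)) = 0,
            (2 * h)^-1 *: (grad dot E (xh + h *: vh) - grad dot E (xh - h *: vh))
              = lh *: vh,
            2^-1 * `|vh| ^+ 2 = 2^-1 :> R &
            `|xh - xs| + `|vh - vs| + `|lh - ls| <= C * h ^+ 2].
Proof.
have [G0 [A_sym [l [v [_ uniq_eigen l0 [mu [mu0 Amu]]]]]] eigen v1] := saddle.
have [ll [c vsE]] := uniq_eigen _ _ eigen; have [_ Av _] := eigen.
rewrite -ll in l0.
(* Coercivity is given on the complement of the eigenvector [v]. Uniqueness makes [vs] a multiple of
   [v], nonzero since [vs] is a unit vector, so both complements agree. *)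
have c0 : c != 0.
  apply: contra_eq_neq v1 => c0.
  by rewrite vsE c0 scale0r normr0 eq_sym oner_eq0.
have Amu_vs w : dot w vs = 0 -> mu * `|w| ^+ 2 <= dot w (hess dot E xs w).
  rewrite vsE dotZr => /eqP; rewrite mulf_eq0 (negbTE c0) => /eqP; exact: Amu.
have [h0 [C [h00 sol]]] := saddle_continuation dot_norm (Ck_grad dot_norm E_C4)
  G0 A_sym Av v1 l0 mu0 Amu_vs.
exists h0, C; split=> // h hgt0 hle.
have [x [w [lam [avg0 diff_eq w1 err]]]] := sol h hgt0 hle.
exists x, w, lam; split=> //.
by rewrite w1 expr1n mulr1.
Qed.
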